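(* Let $a_0,a_1,a_2,\dots$ be complex numbers, with associated matrices $T_r,\tilde T_r,Q_r$ as defined in the context. If one of the three nondecreasing sequences $$\left\{\nu(I_r-T_rT_r^* )\right\}_{r=1}^\infty,\quad \left\{\nu(I_r-\tilde T_r\tilde T_r^* )\right\}_{r=1}^\infty,\quad \left\{\nu\begin{pmatrix}I_r-T_rT_r^*&Q_r\\Q_r^*&I_r-\tilde T_r\tilde T_r^*\end{pmatrix}\right\}_{r=1}^\infty$$ has constant value $\kappa$ from some point on, then all do. If one of the three nondecreasing sequences $$\left\{\pi(I_r-T_rT_r^* )\right\}_{r=1}^\infty,\quad \left\{\pi(I_r-\tilde T_r\tilde T_r^* )\right\}_{r=1}^\infty,\quad \left\{\pi\begin{pmatrix}I_r-T_rT_r^*&Q_r\\Q_r^*&I_r-\tilde T_r\tilde T_r^*\end{pmatrix}\right\}_{r=1}^\infty$$ has constant value $\kappa$ from some point on, then all do.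
   Context: For a Hermitian matrix $A$, $\pi(A)$ and $\nu(A)$ denote the numbers of positive and negative eigenvalues of $A$ counting multiplicity. $I_r$ is the $r\times r$ identity matrix and $X^*$ the conjugate transpose. $T_r$ is the $r\times r$ lower triangular Toeplitz matrix with entries $(T_r)_{ij}=a_{i-j}$ for $i\ge j$ and $0$ for $i<j$ ($0\le i,j\le r-1$), and $\tilde T_r$ is its entrywise complex conjugate. $Q_r$ is the $r\times r$ Hankel matrix with entries $(Q_r)_{ij}=a_{i+j+1}$, $0\le i,j\le r-1$. *)

(* Defs.v *)
From HB Require Import structures.
From mathcomp Require Import all_boot all_order all_algebra.
From mathcomp Require Import sesquilinear spectral complex reals.
Set Implicit Arguments.
Unset Strict Implicit.
Unset Printing Implicit Defensive.
Import Order.TTheory GRing.Theory Num.Theory.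
Local Open Scope ring_scope.
Local Open Scope sesquilinear_scope.

Section Inertia.
Variables (C : numClosedFieldType) (n : nat).
Implicit Type A : 'M[C]_n.

(* Eigenvalues listed with algebraic multiplicity; for Hermitian matrices, the
   only ones used below, this agrees with the geometric multiplicity. *)
Definition eigenvalues A : seq C :=
  sval (closed_field_poly_normal (char_poly A)).

(* The order on C is partial: 0 < x (resp. x < 0) means that x is real and
   positive (resp. negative). *)
Definition num_pos_eig A : nat := count (fun x => 0 < x) (eigenvalues A).

Definition num_neg_eig A : nat := count (fun x => x < 0) (eigenvalues A).

End Inertia.

Section ToeplitzHankel.
Variables (C : numClosedFieldType) (a : nat -> C) (r : nat).

Definition toeplitz : 'M[C]_r :=
  \matrix_(i, j) if (j <= i)%N then a (i - j)%N else 0.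

Definition toeplitz_conj : 'M[C]_r := map_mx Num.conj toeplitz.

Definition hankel : 'M[C]_r := \matrix_(i, j) a (i + j + 1)%N.

Definition defect : 'M[C]_r := 1%:M - toeplitz *m toeplitz ^t*.

Definition defect_conj : 'M[C]_r := 1%:M - toeplitz_conj *m toeplitz_conj ^t*.

Definition defect_block : 'M[C]_(r + r) :=
  block_mx defect hankel (hankel ^t*) defect_conj.

End ToeplitzHankel.

(* Sequences are indexed by r >= 1; the value at 0 (an empty matrix) is
   irrelevant to both predicates. *)
Definition nondecreasing_from1 (u : nat -> nat) : Prop :=
  forall r, (0 < r)%N -> (u r <= u r.+1)%N.

Definition eventually_equal (u : nat -> nat) (k : nat) : Prop :=
  exists r0, forall r, (r0 <= r)%N -> u r = k.

(* Main.v *)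
Require Import Defs.
From HB Require Import structures.
From mathcomp Require Import all_boot all_order all_algebra.
From mathcomp Require Import sesquilinear spectral complex reals.
Set Implicit Arguments.
Unset Strict Implicit.
Unset Printing Implicit Defensive.
Import Order.TTheory GRing.Theory Num.Theory.
Local Open Scope ring_scope.
Local Open Scope sesquilinear_scope.

(** The three sequences are one sequence in disguise.  Write T for the Toeplitz
matrix of order r, X for the one of order 2r, and J for the reversal of the
coordinates; then X is the block matrix [T 0; H T] with H Toeplitz.

- The conjugated defect is the transpose of the Hermitian matrix I - T T^*, so
  both have the same characteristic polynomial ([defect_conjE]).
- Since H J is the Hankel matrix and J T J = T^T, conjugating the block defect
  by diag(I, J) turns it into [I - T T^*, H; H^*, I - T^* T].  This matrix and
  I - X X^* are both Schur complements of identity blocks of order 2r in one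
  Hermitian matrix of order 4r, namely [I X^*; X I]; hence they have the same
  numbers of positive and of negative eigenvalues ([inertia_dilation]).  So the
  third sequence at r is exactly the first one at 2r ([inertia_defect_block]).

The first sequence is nondecreasing because I - T T^* is the leading principal
submatrix of the next one, and a nondecreasing sequence is eventually equal to
kappa as soon as its values at even indices are.

The facts about inertia used above (Sylvester's law, monotonicity under
compression) all come from one inequality, [inertia_congr_le]: for A
Hermitian and P rectangular, P A P^* never has more positive eigenvalues than A.
It follows from the variational description of the number of positive eigenvalues
as the largest dimension of a subspace on which the form is positive definite
([inertia_witness] and [leq_inertia]). *)

(** * Eigenvalues and characteristic polynomials *)

Section Eigenvalues.
Variable C : numClosedFieldType.

Lemma char_poly_similar n (P A : 'M[C]_n) :
  P \in unitmx -> char_poly (invmx P *m A *m P) = char_poly A.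
Proof.
move=> uP; rewrite /char_poly.
have -> : char_poly_mx (invmx P *m A *m P) =
    map_mx polyC (invmx P) *m char_poly_mx A *m map_mx polyC P.
  rewrite /char_poly_mx mulmxBr mulmxBl !map_mxM; congr (_ - _).
  by rewrite scalar_mxC -mulmxA -map_mxM mulVmx // map_mx1 mulmx1.
by rewrite !det_mulmx mulrAC -det_mulmx -map_mxM mulVmx // map_mx1 det1 mul1r.
Qed.

Lemma char_poly_tr n (A : 'M[C]_n) : char_poly A^T = char_poly A.
Proof.
rewrite /char_poly -det_tr; congr (\det _).
by rewrite /char_poly_mx linearB /= map_trmx trmxK tr_scalar_mx.
Qed.

Lemma char_poly_block_diag m n (A : 'M[C]_m) (B : 'M[C]_n) :
  char_poly (block_mx A 0 0 B) = char_poly A * char_poly B.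
Proof.
rewrite /char_poly -(det_lblock _ 0); congr (\det _).
rewrite /char_poly_mx map_block_mx !map_mx0 scalar_mx_block.
by rewrite opp_block_mx add_block_mx !subr0.
Qed.

Lemma eigenvaluesE n (A : 'M[C]_n) :
  \prod_(x <- eigenvalues A) ('X - x%:P) = char_poly A.
Proof.
rewrite /eigenvalues; case: closed_field_poly_normal => s /= As; rewrite [RHS]As.
by rewrite (monicP (char_poly_monic A)) scale1r.
Qed.

Lemma perm_eigenvalues n (A : 'M[C]_n) s :
  char_poly A = \prod_(x <- s) ('X - x%:P) -> perm_eq (eigenvalues A) s.
Proof. by move=> As; apply: prod_XsubC_eq; rewrite eigenvaluesE. Qed.

Lemma eq_eigenvalues m n (A : 'M[C]_m) (B : 'M[C]_n) :
  char_poly A = char_poly B -> eigenvalues A = eigenvalues B.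
Proof. by rewrite /eigenvalues => ->. Qed.

(** The values c = 1 and c = -1 give the two counts of the theorem; carrying c
along proves the statements about both signs at once. *)
Definition inertia (c : C) n (A : 'M[C]_n) : nat :=
  count (fun x => 0 < c * x) (eigenvalues A).

Lemma num_pos_eigE n (A : 'M[C]_n) : num_pos_eig A = inertia 1 A.
Proof. by apply: eq_count => x; rewrite /= mul1r. Qed.

Lemma num_neg_eigE n (A : 'M[C]_n) : num_neg_eig A = inertia (-1) A.
Proof. by apply: eq_count => x; rewrite /= mulN1r oppr_gt0. Qed.

Lemma inertia_tr c n (A : 'M[C]_n) : inertia c A^T = inertia c A.
Proof. by rewrite /inertia (eq_eigenvalues (char_poly_tr A)). Qed.

Lemma inertia_block_diag c m n (A : 'M[C]_m) (B : 'M[C]_n) :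
  inertia c (block_mx A 0 0 B) = (inertia c A + inertia c B)%N.
Proof.
rewrite /inertia -count_cat; apply/permP/perm_eigenvalues.
by rewrite char_poly_block_diag big_cat /= !eigenvaluesE.
Qed.

Lemma inertia_spectral c n (A : 'M[C]_n) : A \is hermsymmx ->
  inertia c A = #|[set i | 0 < c * spectral_diag A 0 i]|.
Proof.
move=> /hermitian_normalmx /orthomx_spectralP defA.
have perm_sp : perm_eq (eigenvalues A) [seq spectral_diag A 0 i | i : 'I_n].
  apply: perm_eigenvalues; rewrite {1}defA char_poly_similar ?spectral_unit //.
  rewrite char_poly_trig ?diag_mx_is_trig // big_map big_enum /=.
  by apply: eq_bigr => i _; rewrite mxE eqxx.
rewrite /inertia (permP perm_sp) count_map enumT.
rewrite cardsE cardE /enum_mem size_filter.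
exact: eq_count.
Qed.

End Eigenvalues.

(** * Inertia of Hermitian matrices *)

Section Sylvester.
Variable C : numClosedFieldType.

Lemma trmxC_hermsymmx n (A : 'M[C]_n) : A ^t* = A -> A \is hermsymmx.
Proof. by move=> hA; apply/is_hermitianmxP; rewrite expr0 scale1r hA. Qed.

Lemma trmxC_mul m n p (A : 'M[C]_(m, n)) (B : 'M[C]_(n, p)) :
  (A *m B) ^t* = B ^t* *m A ^t*.
Proof. by rewrite trmx_mul map_mxM. Qed.

Definition hform n (A : 'M[C]_n) (x : 'rV[C]_n) : C := (x *m A *m x ^t*) 0 0.

Lemma hform_congr m n (A : 'M[C]_n) (P : 'M[C]_(m, n)) x :
  hform (P *m A *m P ^t*) x = hform A (x *m P).
Proof. by rewrite /hform trmxC_mul !mulmxA. Qed.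

Lemma hform_diag n (d z : 'rV[C]_n) :
  hform (diag_mx d) z = \sum_i d 0 i * `|z 0 i| ^+ 2.
Proof.
rewrite /hform mxE; apply: eq_bigr => i _.
by rewrite mul_mx_diag !mxE normCK mulrCA mulrA.
Qed.

Lemma hform_spectral n (A : 'M[C]_n) x : A ^t* = A ->
  hform A x = hform (diag_mx (spectral_diag A)) (x *m (spectralmx A) ^t*).
Proof.
move=> hA; rewrite -hform_congr trmxCK.
rewrite {1}[A](orthomx_spectralP (hermitian_normalmx (trmxC_hermsymmx hA))).
by rewrite (invmx_unitary (spectral_unitarymx A)).
Qed.

Lemma mxsub_congr m n (f : 'I_m -> 'I_n) (A : 'M[C]_n) :
  mxsub f f A = rowsub f 1%:M *m A *m (rowsub f 1%:M) ^t*.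
Proof.
rewrite mul_rowsub_mx mul1mx.
have -> : (rowsub f 1%:M) ^t* = colsub f (1%:M : 'M[C]_n).
  by apply/matrixP=> i j; rewrite !mxE eq_sym conjC_nat.
by rewrite mulmx_colsub mulmx1 -mxsubcr.
Qed.

(** The witness consists of the rows of the diagonalizing unitary matrix that
belong to the eigenvalues counted by the inertia. *)
Lemma inertia_witness (c : C) n (A : 'M[C]_n) : A ^t* = A ->
  exists U : 'M[C]_(inertia c A, n),
    forall y, y != 0 -> 0 < c * hform A (y *m U).
Proof.
move=> hA; rewrite (inertia_spectral c (trmxC_hermsymmx hA)).
set J := [set i | _]; set d := spectral_diag A.
pose f := fun k : 'I_#|J| => enum_val k.
exists (rowsub f (spectralmx A)) => y y0.
rewrite hform_spectral // -/d.
have -> : y *m rowsub f (spectralmx A) *m (spectralmx A) ^t* = y *m rowsub f 1%:M.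
  rewrite -mulmxA mul_rowsub_mx.
  by have /unitarymxP -> := spectral_unitarymx A.
rewrite -hform_congr -mxsub_congr.
have -> : mxsub f f (diag_mx d) = diag_mx (\row_k d 0 (f k)).
  by apply/matrixP=> k l; rewrite !mxE (inj_eq enum_val_inj).
rewrite hform_diag mulr_sumr.
have c_gt0 k : 0 < c * d 0 (f k) by have := enum_valP k; rewrite inE.
have /rV0Pn [k yk] := y0.
rewrite (bigD1 k) //= ltr_pwDl //.
  by rewrite mxE mulrA mulr_gt0 // exprn_gt0 // normr_gt0.
apply: sumr_ge0 => i _; rewrite mxE mulrA mulr_ge0 //; first exact: ltW.
by rewrite exprn_ge0.
Qed.

(** If the k-dimensional row space of U were too large, it would contain a
nonzero vector orthogonal to all the eigenvectors counted by the inertia, and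
the form, multiplied by c, would be nonpositive there. *)
Lemma leq_inertia (c : C) n k (A : 'M[C]_n) (U : 'M[C]_(k, n)) :
    c \is Num.real -> A ^t* = A ->
    (forall y, y != 0 -> 0 < c * hform A (y *m U)) ->
  (k <= inertia c A)%N.
Proof.
move=> cR hA Upos; rewrite (inertia_spectral c (trmxC_hermsymmx hA)).
set J := [set i | _]; set d := spectral_diag A.
have dR i : d 0 i \is Num.real.
  by have /mxOverP := hermitian_spectral_diag_real (trmxC_hermsymmx hA); apply.
rewrite leqNgt; apply/negP => lt_pk.
pose f := fun i : 'I_#|J| => enum_val i.
pose M := colsub f (U *m (spectralmx A) ^t*).
have kerM : kermx M != 0.
  rewrite -mxrank_eq0 mxrank_ker subn_eq0 -ltnNge.
  exact: leq_ltn_trans (rank_leq_col _) lt_pk.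
have /rowV0Pn [y /sub_kermxP yM y0] := kerM.
have := Upos y y0; rewrite hform_spectral // -/d hform_diag mulr_sumr.
set z := _ *m _ => zpos.
have zJ i : i \in J -> z 0 i = 0.
  move=> iJ; have := congr1 (fun w : 'rV_ _ => w 0 (enum_rank_in iJ i)) yM.
  rewrite mulmx_colsub mulmxA -/z.
  rewrite [LHS]mxE /f enum_rankK_in // => ->.
  exact: mxE.
have : \sum_i c * (d 0 i * `|z 0 i| ^+ 2) <= 0.
  apply: sumr_le0 => i _; have [iJ|] := boolP (i \in J).
    by rewrite zJ // normr0 expr0n /= !mulr0.
  rewrite inE -real_leNgt ?real0 ?realM // mulrA => cd_le0.
  by rewrite mulr_le0_ge0 ?exprn_ge0.
by move/(lt_le_trans zpos); rewrite ltxx.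
Qed.

Lemma herm_congr m n (A : 'M[C]_n) (P : 'M[C]_(m, n)) :
  A ^t* = A -> (P *m A *m P ^t*) ^t* = P *m A *m P ^t*.
Proof. by move=> hA; rewrite !trmxC_mul trmxCK hA mulmxA. Qed.

(** A subspace on which the congruent form is definite is mapped by P to one on
which the form of A is definite, without loss of dimension: a vector in the
kernel of P would be isotropic. *)
Lemma inertia_congr_le (c : C) m n (A : 'M[C]_n) (P : 'M[C]_(m, n)) :
  c \is Num.real -> A ^t* = A -> (inertia c (P *m A *m P ^t*) <= inertia c A)%N.
Proof.
move=> cR hA; have [U Upos] := inertia_witness c (herm_congr P hA).
apply: (@leq_inertia c n _ A (U *m P)) => // y /Upos.
by rewrite hform_congr mulmxA.
Qed.

(** Sylvester's law of inertia, for a P that has a left inverse. *)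
Lemma inertia_congr (c : C) m n (A : 'M[C]_n) (P : 'M[C]_(m, n)) Q :
  c \is Num.real -> A ^t* = A -> Q *m P = 1%:M ->
  inertia c (P *m A *m P ^t*) = inertia c A.
Proof.
move=> cR hA QP; apply/eqP; rewrite eqn_leq inertia_congr_le //=.
have {1}<- : Q *m (P *m A *m P ^t*) *m Q ^t* = A.
  by rewrite !mulmxA QP mul1mx -mulmxA -trmxC_mul QP trmx1 map_mx1 mulmx1.
by rewrite inertia_congr_le // herm_congr.
Qed.

Lemma inertia_mxsub_le (c : C) m n (f : 'I_m -> 'I_n) (A : 'M[C]_n) :
  c \is Num.real -> A ^t* = A -> (inertia c (mxsub f f A) <= inertia c A)%N.
Proof. by move=> cR hA; rewrite mxsub_congr inertia_congr_le. Qed.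

Lemma trmxC_block m1 m2 n1 n2 (A : 'M[C]_(m1, n1)) (B : 'M[C]_(m1, n2))
    (D : 'M[C]_(m2, n1)) (E : 'M[C]_(m2, n2)) :
  (block_mx A B D E) ^t* = block_mx (A ^t*) (D ^t*) (B ^t*) (E ^t*).
Proof. by rewrite tr_block_mx map_block_mx. Qed.

Lemma trmxC1 n : (1%:M : 'M[C]_n) ^t* = 1%:M.
Proof. by rewrite trmx1 map_mx1. Qed.

Lemma trmxC0 m n : (0 : 'M[C]_(m, n)) ^t* = 0.
Proof. by rewrite trmx0 map_mx0. Qed.

Lemma trmxCB m n (A B : 'M[C]_(m, n)) : (A - B) ^t* = A ^t* - B ^t*.
Proof. by rewrite linearB /= map_mxB. Qed.

Definition trmxCE := (trmxC_block, trmxCB, trmxC_mul, trmxC1, trmxC0, @trmxCK C).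

(** Block Gaussian elimination by a unipotent triangular matrix is a congruence
from the block matrix to the direct sum of I and the Schur complement. *)
Lemma inertia_schur (c : C) m n (B : 'M[C]_(m, n)) (D : 'M[C]_n) :
  c \is Num.real -> D ^t* = D ->
  inertia c (block_mx 1%:M B (B ^t*) D) =
  (inertia c (1%:M : 'M[C]_m) + inertia c (D - B ^t* *m B))%N.
Proof.
move=> cR hD; rewrite -inertia_block_diag.
pose L (X : 'M[C]_(n, m)) := block_mx (1%:M : 'M[C]_m) 0 X 1%:M.
have -> : block_mx 1%:M B (B ^t*) D =
    L (B ^t*) *m block_mx 1%:M 0 0 (D - B ^t* *m B) *m (L (B ^t*)) ^t*.
  rewrite /L !trmxCE !mulmx_block.
  by rewrite !(mulmx1, mul1mx, mul0mx, mulmx0, addr0, add0r) addrC subrK.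
apply: (@inertia_congr c _ _ _ _ (L (- B ^t*))) => //.
  by rewrite !trmxCE hD.
rewrite /L mulmx_block.
by rewrite !(mulmx1, mul1mx, mul0mx, mulmx0, addr0, add0r) addNr -scalar_mx_block.
Qed.

(** Both sides are Schur complements in the Hermitian matrix M = [I X^*; X I] of
order 4r, acting on (y1, y2, x1, x2).  Eliminating y1 and y2 leaves I - X X^*.
The zero block of X makes x1 and y2 uncoupled in M, so they can be eliminated
together as well, and what remains on (x2, y1) is the right-hand side. *)
Lemma inertia_dilation (c : C) r (T H : 'M[C]_r) : c \is Num.real ->
  let X := block_mx T 0 H T in
  inertia c (1%:M - X *m X ^t*) =
  inertia c (block_mx (1%:M - T *m T ^t*) H (H ^t*) (1%:M - T ^t* *m T)).
Proof.
move=> cR X; apply: (@addnI (inertia c (1%:M : 'M[C]_(r + r)))).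
have := inertia_schur (X ^t*) cR (trmxC1 _); rewrite trmxCK => <-.
(* [I B; B^* D] is M with its coordinates reordered as (x1, y2, x2, y1). *)
pose B := block_mx 0 T (T ^t*) 0.
pose D := block_mx (1%:M : 'M[C]_r) H (H ^t*) 1%:M.
have hD : D ^t* = D by rewrite !trmxCE.
have -> : block_mx (1%:M - T *m T ^t*) H (H ^t*) (1%:M - T ^t* *m T) =
    D - B ^t* *m B.
  rewrite /D /B !trmxCE mulmx_block opp_block_mx add_block_mx.
  by rewrite !(mul0mx, mulmx0, addr0, add0r) oppr0 !addr0.
rewrite -(inertia_schur B cR hD).
(* P is the permutation matrix that performs this reordering. *)
pose P : 'M[C]_((r + r) + (r + r)) :=
  block_mx (block_mx 0 0 0 1%:M) (block_mx 1%:M 0 0 0)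
           (block_mx 0 0 1%:M 0) (block_mx 0 1%:M 0 0).
have PP : P ^t* *m P = 1%:M.
  rewrite /P !trmxCE !mulmx_block !add_block_mx.
  rewrite !(mulmx1, mul1mx, mul0mx, mulmx0, addr0, add0r).
  by rewrite -!scalar_mx_block block_mx0 -scalar_mx_block.
rewrite -(inertia_congr cR _ PP); last by rewrite !trmxCE.
congr (inertia c _).
rewrite /P /X /B /D !trmxCE [1%:M in X in _ *m X *m _]scalar_mx_block.
rewrite !mulmx_block !add_block_mx.
rewrite !(mulmx1, mul1mx, mul0mx, mulmx0, addr0, add0r).
rewrite !mulmx_block !add_block_mx.
by rewrite !(mulmx1, mul1mx, mul0mx, mulmx0, addr0, add0r) -scalar_mx_block.
Qed.

End Sylvester.

(** * The defect matrices of a lower triangular Toeplitz matrix *)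

Section ToeplitzInertia.
Variables (C : numClosedFieldType) (a : nat -> C).

Lemma herm_defect r : (defect a r) ^t* = defect a r.
Proof. by rewrite /defect !trmxCE. Qed.

Lemma defect_conjE r : defect_conj a r = (defect a r)^T.
Proof.
have -> : (defect a r)^T = map_mx Num.conj (defect a r).
  by rewrite -{1}herm_defect -map_trmx trmxK.
rewrite /defect map_mxB map_mx1 map_mxM.
by rewrite /defect_conj /toeplitz_conj map_trmx.
Qed.

Lemma inertia_defect_conj c r :
  inertia c (defect_conj a r) = inertia c (defect a r).
Proof. by rewrite defect_conjE inertia_tr. Qed.

(** The sum over k vanishes beyond the row index i, so its range may be cut or
extended at any n >= i: an entry of the defect does not depend on the order of
the matrix, which makes the defects nested principal submatrices. *)
Lemma defectE r (i j : 'I_r) n : (i <= n)%N ->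
  defect a r i j = (i == j)%:R -
  \sum_(0 <= k < n.+1) (if (k <= i)%N then a (i - k)%N else 0) *
    (if (k <= j)%N then a (j - k)%N else 0)^*.
Proof.
move=> le_in; rewrite !mxE; congr (_ - _).
have big_i m : (i < m)%N ->
    \sum_(0 <= k < m) (if (k <= i)%N then a (i - k)%N else 0) *
      (if (k <= j)%N then a (j - k)%N else 0)^* =
    \sum_(0 <= k < i.+1) (if (k <= i)%N then a (i - k)%N else 0) *
      (if (k <= j)%N then a (j - k)%N else 0)^*.
  move=> lt_im; rewrite (big_cat_nat (leq0n i.+1) lt_im) //=.
  rewrite [X in _ + X]big_nat_cond.
  rewrite [X in _ + X]big1 ?addr0 // => k; rewrite andbT => /andP[ik _].
  by rewrite leqNgt ik mul0r.
rewrite big_i // -(big_i r) ?ltn_ord // big_mkord.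
by apply: eq_bigr => k _; rewrite !mxE.
Qed.

Lemma inertia_defect_homo (c : C) r s : c \is Num.real -> (r <= s)%N ->
  (inertia c (defect a r) <= inertia c (defect a s))%N.
Proof.
move=> cR le_rs.
have -> : defect a r = mxsub (widen_ord le_rs) (widen_ord le_rs) (defect a s).
  apply/matrixP=> i j; rewrite [RHS]mxE (defectE _ (leqnn i)).
  by rewrite (@defectE s _ _ i).
exact: inertia_mxsub_le cR (herm_defect s).
Qed.

(** The diagonal congruence by I and the reversal J exchanges Hankel and Toeplitz
blocks, and brings the block defect to the form given by the dilation of
order 2r. *)
Lemma inertia_defect_block (c : C) r : c \is Num.real ->
  inertia c (defect_block a r) = inertia c (defect a (r + r)).
Proof.
move=> cR.
pose T := toeplitz a r; pose H : 'M[C]_r := \matrix_(i, j) a (r + i - j)%N.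
pose E := block_mx (1%:M - T *m T ^t*) H (H ^t*) (1%:M - T ^t* *m T).
have hE : E ^t* = E by rewrite !trmxCE.
have toeplitz_block : toeplitz a (r + r) = block_mx T 0 H T.
  apply/matrixP=> i j; rewrite mxE.
  case: (split_ordP i) => i' ->; case: (split_ordP j) => j' ->.
  - by rewrite block_mxEul !mxE.
  - by rewrite block_mxEur !mxE /= leqNgt ltn_addr.
  - by rewrite block_mxEdl !mxE /= (leq_trans (ltnW (ltn_ord j'))) ?leq_addr.
  - by rewrite block_mxEdr !mxE /= leq_add2l subnDl.
rewrite [in RHS]/defect toeplitz_block.
rewrite (inertia_dilation T H cR) -/E.
pose J := rowsub (@rev_ord r) (1%:M : 'M[C]_r).
have JE : J = colsub (@rev_ord r) 1%:M.
  by apply/matrixP=> i j; rewrite !mxE (can2_eq rev_ordK rev_ordK).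
have trJ : J ^t* = J.
  by rewrite [in RHS]JE; apply/matrixP=> i j; rewrite !mxE conjC_nat eq_sym.
have JK : J *m J = 1%:M.
  rewrite mul_rowsub_mx mul1mx -rowsub_comp.
  by apply: mxsub_eq_id => // i /=; rewrite rev_ordK.
pose P := block_mx (1%:M : 'M[C]_r) 0 0 J.
have PK : P *m P = 1%:M.
  rewrite /P mulmx_block !(mulmx1, mul1mx, mul0mx, mulmx0, addr0, add0r) JK.
  by rewrite -scalar_mx_block.
rewrite -(inertia_congr cR hE PK); congr (inertia c _).
have HJ : H *m J = hankel a r.
  rewrite JE mulmx_colsub mulmx1; apply/matrixP=> i j; rewrite !mxE /=.
  by rewrite subnBA // -addnA addKn -addnA addn1.
(* A Toeplitz matrix is symmetric about its antidiagonal. *)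
have JTJ : J *m T *m J = T^T.
  rewrite -{2}trJ -mxsub_congr; apply/matrixP=> i j; rewrite !mxE /=.
  rewrite leq_sub2lE // ltnS; case: ifP => // le_ij.
  by rewrite subnBA // addnBAC // subnAC addKn subSS.
have conjT_tr : (toeplitz_conj a r) ^t* = J *m T *m J.
  by rewrite JTJ; apply/matrixP=> i j; rewrite !mxE conjCK.
have conjT : toeplitz_conj a r = J *m T ^t* *m J.
  by rewrite -[LHS]trmxCK conjT_tr !trmxCE trJ mulmxA.
rewrite /P /E !trmxCE trJ !mulmx_block.
rewrite !(mulmx1, mul1mx, mul0mx, mulmx0, addr0, add0r).
rewrite /defect_block; congr block_mx => //.
- by rewrite -HJ trmxC_mul trJ.
rewrite /defect_conj conjT_tr {1}conjT mulmxBr mulmxBl mulmx1 JK.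
by rewrite !mulmxA -[X in X *m T]mulmxA JK mulmx1.
Qed.

End ToeplitzInertia.

(** * Passage to the limit *)

Lemma eventually_equal_double (u : nat -> nat) k :
    {homo u : r s / (r <= s)%N} ->
  eventually_equal (fun r => u (r + r)%N) k <-> eventually_equal u k.
Proof.
move=> u_homo; split=> -[r0 u_k]; last first.
  by exists r0 => r le_r; apply/u_k/(leq_trans le_r)/leq_addr.
exists (r0 + r0)%N => r le_r; have le_r0 := leq_trans (leq_addr _ _) le_r.
apply/eqP; rewrite eqn_leq -{1}(u_k r le_r0) -(u_k r0 (leqnn r0)).
by rewrite !u_homo ?leq_addr.
Qed.

Lemma eq_eventually_equal (u v : nat -> nat) k :
  u =1 v -> eventually_equal u k <-> eventually_equal v k.
Proof.
by move=> uv; split=> -[r0 eq_k]; exists r0 => r /eq_k <-; rewrite uv.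
Qed.

Lemma inertia_sequences (C : numClosedFieldType) (a : nat -> C) (c : C)
    (u1 u2 u3 : nat -> nat) : c \is Num.real ->
    (forall r, u1 r = inertia c (defect a r)) ->
    (forall r, u2 r = inertia c (defect_conj a r)) ->
    (forall r, u3 r = inertia c (defect_block a r)) ->
  [/\ nondecreasing_from1 u1, nondecreasing_from1 u2 & nondecreasing_from1 u3] /\
  (forall k,
     [\/ eventually_equal u1 k, eventually_equal u2 k | eventually_equal u3 k] ->
     [/\ eventually_equal u1 k, eventually_equal u2 k & eventually_equal u3 k]).
Proof.
move=> cR u1E u2E u3E.
have u1_homo : {homo u1 : r s / (r <= s)%N}.
  by move=> r s le_rs; rewrite !u1E inertia_defect_homo.
have u21 : u2 =1 u1 by move=> r; rewrite u2E u1E inertia_defect_conj.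
have u31 : u3 =1 (fun r => u1 (r + r)%N).
  by move=> r; rewrite u3E u1E inertia_defect_block.
split.
  split=> r _; rewrite ?u21 ?u31; apply: u1_homo => //.
  by rewrite leq_add.
move=> k; have lim2 := eq_eventually_equal k u21.
have lim3 : eventually_equal u3 k <-> eventually_equal u1 k.
  by rewrite -(eventually_equal_double k u1_homo); apply: eq_eventually_equal.
move=> lim; have lim1 : eventually_equal u1 k by case: lim; tauto.
by split; tauto.
Qed.

Theorem corollary3p3 (R : realType) (a : nat -> R[i]) :
  let nu1 := fun r : nat => num_neg_eig (defect a r) in
  let nu2 := fun r : nat => num_neg_eig (defect_conj a r) in
  let nu3 := fun r : nat => num_neg_eig (defect_block a r) in
  let pi1 := fun r : nat => num_pos_eig (defect a r) in
  let pi2 := fun r : nat => num_pos_eig (defect_conj a r) in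
  let pi3 := fun r : nat => num_pos_eig (defect_block a r) in
  [/\ nondecreasing_from1 nu1, nondecreasing_from1 nu2 & nondecreasing_from1 nu3] /\
  [/\ nondecreasing_from1 pi1, nondecreasing_from1 pi2 & nondecreasing_from1 pi3] /\
  (forall kappa : nat,
     [\/ eventually_equal nu1 kappa, eventually_equal nu2 kappa
       | eventually_equal nu3 kappa] ->
     [/\ eventually_equal nu1 kappa, eventually_equal nu2 kappa
       & eventually_equal nu3 kappa]) /\
  (forall kappa : nat,
     [\/ eventually_equal pi1 kappa, eventually_equal pi2 kappa
       | eventually_equal pi3 kappa] ->
     [/\ eventually_equal pi1 kappa, eventually_equal pi2 kappa
       & eventually_equal pi3 kappa]).
Proof.
move=> nu1 nu2 nu3 pi1 pi2 pi3.
have realN1 : (-1 : R[i]) \is Num.real by rewrite realN real1.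
have [nu_mono nu_lim] := inertia_sequences realN1
  (fun r => num_neg_eigE (defect a r)) (fun r => num_neg_eigE (defect_conj a r))
  (fun r => num_neg_eigE (defect_block a r)).
have [pi_mono pi_lim] := inertia_sequences (real1 _)
  (fun r => num_pos_eigE (defect a r)) (fun r => num_pos_eigE (defect_conj a r))
  (fun r => num_pos_eigE (defect_block a r)).
exact: conj nu_mono (conj pi_mono (conj nu_lim pi_lim)).
Qed.
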